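(* Let $\epsilon>0$, $\mu>0$, let $f$ be a twice differentiable function such that $\eta=-\rho f(s)$ is strictly convex as a function of the state $[\rho,\mathbf m,\mathcal E,\mathbf B]^{\top}$ (a generalized Harten entropy). Then any smooth solution $[\rho,\mathbf m,\mathcal E,\mathbf B]^{\top}$ of the viscous regularization of the divergence-form MHD system $$\partial_t\rho+\mathrm{div}\,\mathbf m=\epsilon\Delta\rho,$$ $$\partial_t\mathbf m+\mathrm{div}\Big(\rho^{-1}\mathbf m\mathbf m^{\top}-\mu^{-1}\mathbf B\mathbf B^{\top}+\mathbb I\big(p+\tfrac1{2\mu}|\mathbf B|^2\big)\Big)=\epsilon\Delta\mathbf m,$$ $$\partial_t\mathcal E+\mathrm{div}\Big(\tfrac{\mathbf m}{\rho}\big(\mathcal E+p+\tfrac1{2\mu}|\mathbf B|^2\big)-\mu^{-1}\mathbf B\big(\mathbf B^{\top}\tfrac{\mathbf m}{\rho}\big)\Big)=\epsilon\Delta\big(\mathcal E-\tfrac1{2\mu}|\mathbf B|^2\big),$$ $$\partial_t\mathbf B+\mathrm{div}\big(\rho^{-1}\mathbf B\mathbf m^{\top}-\rho^{-1}\mathbf m\mathbf B^{\top}\big)=\mathbf 0,$$ with divergence-free initial magnetic field, satisfies the entropy inequality $$\partial_t\big(\rho f(s)\big)+\mathrm{div}\big(\mathbf u\,\rho f(s)-\epsilon\rho\nabla f(s)-\epsilon f(s)\nabla\rho\big)\ \ge\ 0 .$$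
   Context: Notation: $\rho$ is the density, $\mathbf m$ the momentum, $\mathbf u=\mathbf m/\rho$ the velocity, $\mathbf B$ the magnetic field, $\mathcal E=\tfrac1{2\rho}|\mathbf m|^2+\rho e+\tfrac1{2\mu}|\mathbf B|^2$ the total energy including the magnetic energy, $e$ the specific internal energy, so $e=\rho^{-1}\big(\mathcal E-\tfrac{1}{2\rho}|\mathbf m|^2-\tfrac1{2\mu}|\mathbf B|^2\big)$; $\mathbb I$ is the $d\times d$ identity matrix, and for a matrix field $(\mathrm{div}\,A)_i=\sum_j\partial_{x_j}A_{ij}$. The spatial domain is $\mathbb R^d$. The initial magnetic field satisfies $\mathrm{div}\,\mathbf B_0=0$, hence $\mathrm{div}\,\mathbf B=0$ for all times. Thermodynamics: the specific entropy is a function $s=s(\rho,e):\mathbb R^+\times\mathbb R^+\to\mathbb R$ consistent with Gibbs' relation $\mathrm ds=\tfrac1\theta\,\mathrm de+\tfrac p\theta\,\mathrm dv$, where $v=\rho^{-1}$ is the specific volume and $\theta$ the temperature. Thus $\partial s/\partial e=1/\theta$, $\partial s/\partial\rho=-p/(\theta\rho^2)$, and the pressure is $p=-\rho^2\,\frac{\partial s}{\partial\rho}\big[\frac{\partial s}{\partial e}\big]^{-1}$. It is assumed that $\frac{\partial s}{\partial e}>0$ (positive temperature) and that $-s$ is strictly convex as a function of $(v,e)=(\rho^{-1},e)$, for all $\rho,e>0$. The density and the internal energy take positive values. In $\eta=-\rho f(s)$ one has $s=s(\rho,e)$ with $e$ regarded as the function of the state given above. *)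

(* Defs.v *)
From HB Require Import structures.
From mathcomp Require Import all_boot all_order all_algebra.
From mathcomp Require Import boolp classical_sets reals topology normedtype derive.

Set Implicit Arguments.
Unset Strict Implicit.
Unset Printing Implicit Defensive.

Import Order.TTheory GRing.Theory Num.Theory numFieldNormedType.Exports.
Local Open Scope ring_scope.
Local Open Scope classical_set_scope.

Section Regularity.
Context {R : realType} {V : normedModType R}.
Implicit Types (A O D : set V) (f : V -> R).

(* For finite-dimensional [V] and open [O] this is the class C^k(O). *)
Fixpoint Ck_on (k : nat) O f : Prop :=
  match k with
  | 0 => forall z, O z -> {for z, continuous f}
  | k'.+1 => (forall z, O z -> differentiable f z) /\
             (forall v : V, Ck_on k' O ('D_v f))
  end.

(* [A] need not be open: smooth means that [f] agrees on [A] with a C^infinity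
   function defined on an open neighbourhood of [A].  The values of [f]
   outside [A] are irrelevant. *)
Definition smooth_on A f : Prop :=
  exists (O : set V) (g : V -> R),
    [/\ open O, A `<=` O, (forall z, A z -> f z = g z) &
        forall k, Ck_on k O g].

Definition twice_differentiable_on O f : Prop :=
  forall z, O z -> differentiable f z /\
                   forall v : V, differentiable ('D_v f) z.

Definition strictly_convex_on D f : Prop :=
  forall (x y : V) (a : R), D x -> D y -> x != y -> 0 < a < 1 ->
    f (a *: x + (1 - a) *: y) < a * f x + (1 - a) * f y.

End Regularity.

(* The norm of the library on ['cV[R]_d] is the sup norm, so the Euclidean
   |v|^2 is written [dot v v]. *)
Definition dot {R : realType} {d : nat} (v w : 'cV[R]_d) : R :=
  \sum_i v i 0 * w i 0.

Section SpaceTime.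
Context {R : realType} {d : nat}.

Implicit Types (f : R * 'cV[R]_d -> R) (F : R * 'cV[R]_d -> 'cV[R]_d)
  (A : R * 'cV[R]_d -> 'M[R]_d) (z : R * 'cV[R]_d).

Definition dt f z : R := 'D_((1, 0) : R * 'cV[R]_d) f z.

Definition dx (j : 'I_d) f z : R :=
  'D_((0, delta_mx j 0) : R * 'cV[R]_d) f z.

Definition dtv F z : 'cV[R]_d := \col_i dt (fun y => F y i 0) z.

Definition grad f z : 'cV[R]_d := \col_j dx j f z.

Definition div F z : R := \sum_j dx j (fun y => F y j 0) z.

Definition divm A z : 'cV[R]_d := \col_i \sum_j dx j (fun y => A y i j) z.

Definition lap f z : R := \sum_j dx j (dx j f) z.

Definition lapv F z : 'cV[R]_d := \col_i lap (fun y => F y i 0) z.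

End SpaceTime.

Section Thermodynamics.
Context {R : realType}.
Implicit Types (s : R -> R -> R) (rho e : R).

(* [s rho e] is the specific entropy as a function of density and specific
   internal energy. *)
Definition ds_drho s rho e : R := derive1 (fun r : R => s r e) rho.

Definition ds_de s rho e : R := derive1 (s rho) e.

Definition pressure s rho e : R := - rho ^+ 2 * ds_drho s rho e / ds_de s rho e.

Definition quadrant : set (R * R) := [set p | 0 < p.1 /\ 0 < p.2].

Record entropy_law s : Prop := EntropyLaw {
  entropy_regular : twice_differentiable_on quadrant (fun p => s p.1 p.2);
  temperature_gt0 : forall rho e, 0 < rho -> 0 < e -> 0 < ds_de s rho e;
  (* here [p] stands for (v, e), with v = 1 / rho *)
  opp_entropy_convex :
    strictly_convex_on quadrant (fun p : R * R => - s p.1^-1 p.2) }.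

End Thermodynamics.

Section MHD.
Context {R : realType} {d : nat}.

(* A state is the tuple (rho, m, E, B), of type [R * 'cV_d * R * 'cV_d]. *)
Implicit Types (U : R * 'cV[R]_d * R * 'cV[R]_d) (s : R -> R -> R)
  (f : R -> R) (mu eps : R).

Definition density U : R := U.1.1.1.
Definition momentum U : 'cV[R]_d := U.1.1.2.
Definition energy U : R := U.1.2.
Definition magnetic U : 'cV[R]_d := U.2.

Definition velocity U : 'cV[R]_d := (density U)^-1 *: momentum U.

Definition magnetic_energy mu U : R :=
  (2 * mu)^-1 * dot (magnetic U) (magnetic U).

Definition internal_energy mu U : R :=
  (density U)^-1 *
  (energy U - (2 * density U)^-1 * dot (momentum U) (momentum U)
   - magnetic_energy mu U).

Definition admissible mu : set (R * 'cV[R]_d * R * 'cV[R]_d) :=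
  [set U | 0 < density U /\ 0 < internal_energy mu U].

Definition specific_entropy mu s U : R :=
  s (density U) (internal_energy mu U).

Definition state_pressure mu s U : R :=
  pressure s (density U) (internal_energy mu U).

Definition harten_eta mu s f U : R :=
  - density U * f (specific_entropy mu s U).

Record harten_entropy mu s f : Prop := HartenEntropy {
  harten_derivable : forall x : R, derivable f x 1;
  harten_derivable2 : forall x : R, derivable (derive1 f) x 1;
  harten_convex : strictly_convex_on (admissible mu) (harten_eta mu s f) }.

Definition momentum_flux mu s U : 'M[R]_d :=
  (density U)^-1 *: (momentum U *m (momentum U)^T)
  - mu^-1 *: (magnetic U *m (magnetic U)^T)
  + (state_pressure mu s U + magnetic_energy mu U)%:M.

Definition energy_flux mu s U : 'cV[R]_d :=
  (energy U + state_pressure mu s U + magnetic_energy mu U) *: velocity U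
  - (mu^-1 * dot (magnetic U) (velocity U)) *: magnetic U.

Definition magnetic_flux U : 'M[R]_d :=
  (density U)^-1 *: (magnetic U *m (momentum U)^T)
  - (density U)^-1 *: (momentum U *m (magnetic U)^T).

Definition viscous_mhd eps mu s (U : R * 'cV[R]_d -> R * 'cV[R]_d * R * 'cV[R]_d)
    (z : R * 'cV[R]_d) : Prop :=
  [/\ dt (density \o U) z + div (momentum \o U) z = eps * lap (density \o U) z,
      dtv (momentum \o U) z + divm (momentum_flux mu s \o U) z
        = eps *: lapv (momentum \o U) z,
      dt (energy \o U) z + div (energy_flux mu s \o U) z
        = eps * lap (fun y => energy (U y) - magnetic_energy mu (U y)) z &
      dtv (magnetic \o U) z + divm (magnetic_flux \o U) z = 0].

(* The solution lives on [0, T) x R^d, the equations being imposed for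
   0 < t < T.  A solution that is global in time is one for every [T]. *)
Record smooth_viscous_mhd_solution (T eps mu : R) s
    (U : R * 'cV[R]_d -> R * 'cV[R]_d * R * 'cV[R]_d) : Prop := SmoothSolution {
  smooth_density :
    smooth_on [set z : R * 'cV[R]_d | 0 <= z.1 < T] (density \o U);
  smooth_momentum : forall i,
    smooth_on [set z : R * 'cV[R]_d | 0 <= z.1 < T] (fun z => momentum (U z) i 0);
  smooth_energy :
    smooth_on [set z : R * 'cV[R]_d | 0 <= z.1 < T] (energy \o U);
  smooth_magnetic : forall i,
    smooth_on [set z : R * 'cV[R]_d | 0 <= z.1 < T] (fun z => magnetic (U z) i 0);
  solution_admissible : forall (t : R) (x : 'cV[R]_d),
    0 <= t < T -> admissible mu (U (t, x));
  solution_eq : forall (t : R) (x : 'cV[R]_d),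
    0 < t < T -> viscous_mhd eps mu s U (t, x) }.

End MHD.

(* Main.v *)
Require Import Defs.
From HB Require Import structures.
From mathcomp Require Import all_boot all_order all_algebra.
From mathcomp Require Import boolp classical_sets functions reals topology normedtype derive.
From mathcomp Require Import interval_inference landau ring lra.

Set Implicit Arguments.
Unset Strict Implicit.
Unset Printing Implicit Defensive.

Import Order.TTheory GRing.Theory Num.Theory numFieldNormedType.Exports.
Local Open Scope ring_scope.
Local Open Scope classical_set_scope.

(** Put [u = m / rho], [W = E - |B|^2 / (2 mu)], and let [F_rho], [F_e] be the
    partial derivatives of [F = f(s)].  Taking the divergence of the induction
    equation shows that [div B] is constant in time, hence zero.  Gibbs' relation
    [p F_e = - rho^2 F_rho] then turns the four equations into
    [d_t (rho F) + div (rho F u)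
       = eps (alpha Lap rho - F_e u . Lap m + F_e Lap W)]
    with [alpha = F + rho F_rho + F_e (|u|^2 / 2 - e)].  The coefficients on the
    right are the partial derivatives of [rho F] with respect to [rho], [m], [W]
    at the state [(rho, m, W, 0)], which has the same internal energy as
    [(rho, m, E, B)].  Since [- rho F] is convex, [rho F] lies below its tangent
    plane along this family of states; their difference has a maximum at the
    point of contact, so [Lap (rho F)] is at most the bracket. *)

(** * Maxima, symmetry of second derivatives and the tangent inequality for directional
    derivatives *)

Section Calculus.
Context {R : realType} {V : normedModType R}.
Implicit Types (f g a b : V -> R) (z v w : V).

(** The difference [g - f] vanishes near [z], so it is differentiable there with zero differential;
    adding it to [f] gives [g]. *)
Lemma near_eq_differentiable f g z :
  (\forall y \near z, f y = g y) -> differentiable f z -> differentiable g z.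
Proof.
move=> fg df.
pose h y := g y - f y.
suff dh : differentiable h z.
  by have -> : g = f + h; [apply/funext => y; rewrite /h fctE subrKC|exact: differentiableD].
have h0 : h z = 0 by rewrite /h (nbhs_singleton fg) subrr.
have cst0 : continuous (cst 0 : V -> R) by move=> ?; exact: cvg_cst.
suff H : h \o shift z = cst (h z) + (cst 0 : V -> R) +o_ 0 id.
  apply/diff_locallyP.
  by have /= -> := diff_unique (df := \0) cst0 H.
apply/eqaddoP => _/posnumP[e].
near=> y; rewrite !fctE /= h0 !addr0 subr0.
suff -> : h (y + z) = 0 by rewrite normr0 mulr_ge0.
rewrite /h; near: y.
have := fg; rewrite (near_shift 0) /= => fg0.
near=> y; apply/eqP; rewrite subr_eq0; apply/eqP/esym.
by rewrite -[z in y + z]subr0; near: y.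
Unshelve. all: by end_near. Qed.

Lemma near0_norm (W : normedModType R) (P : W -> Prop) :
  (\forall k \near 0, P k) -> exists2 r : R, 0 < r & forall k, `|k| < r -> P k.
Proof.
move=> /nbhs_ballP[r r0 rP]; exists r; first exact: r0.
by move=> k kr; apply: rP; rewrite -ball_normE /= sub0r normrN.
Qed.

(** Restriction to a line turns directional derivatives into one-variable ones, to which the mean
    value theorem applies. *)
Lemma is_derive_line f z v (h : R) :
  derivable f (h *: v + z) v ->
  is_derive h 1 (fun k : R => f (k *: v + z)) ('D_v f (h *: v + z)).
Proof.
move=> df.
have E : (fun k : R => k^-1 *: (f (k *: v + (h *: v + z)) - f (h *: v + z))) =
         (fun k : R => k^-1 *: (((fun k : R => f (k *: v + z)) \o shift h) (k *: (1 : R))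
                 - f (h *: v + z))).
  by apply/funext => k /=; rewrite [k *: 1]mulr1 scalerDl addrA.
by split; [move: df; rewrite /derivable /= E | rewrite /derive /= E].
Qed.

Lemma near_line (P : V -> Prop) z v :
  (\forall y \near z, P y) -> \forall h \near (0 : R), P (h *: v + z).
Proof.
rewrite (near_shift 0) => Pz.
by have := near0Z v Pz; apply: filterS => h /=; rewrite subr0.
Qed.

(** At a maximum the derivative [g'] along the line vanishes. If its own derivative at 0 were
    positive, [g'] would be positive just to the right of 0, and the mean value theorem would give
    [g k > g 0]. *)
Lemma second_derive_le0 f z v :
  (\forall y \near z, f y <= f z) -> (\forall y \near z, derivable f y v) ->
  derivable ('D_v f) z v -> 'D_v ('D_v f) z <= 0.
Proof.
move=> fmax df d2f; rewrite leNgt; apply/negP => c_gt0.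
pose g (h : R) : R := f (h *: v + z).
pose g' (h : R) : R := 'D_v f (h *: v + z).
have [r /= r_gt0 gP] : exists2 r : R, 0 < r & forall h, `|h| < r ->
    g h <= g 0 /\ derivable f (h *: v + z) v.
  apply: near0_norm; rewrite /g scale0r add0r.
  by apply: (near_line v (P := fun y => f y <= f z /\ derivable f y v));
      exact: filterI.
have dg (h : R) : `|h| < r -> is_derive h 1 g (g' h).
  by move=> /gP[_]; exact: is_derive_line.
have g'0 : g' 0 = 0.
  have rr : - r <= r by lra.
  have mem0 : (0 : R) \in `]- r, r[%R by rewrite in_itv /= oppr_lt0 r_gt0.
  have inr t : t \in `]- r, r[%R -> `|t| < r by rewrite in_itv /= ltr_norml.
  have H1 (t : R) : t \in `]- r, r[%R -> derivable g t 1.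
    by move=> /inr /dg[].
  have H2 t : t \in `]- r, r[%R -> g t <= g 0 by move=> /inr /gP[].
  have [_ <-] := dg 0 (inr _ mem0); have [_ E] := derive1_at_max rr H1 mem0 H2.
  exact: E.
(* The difference quotient of [g'] at 0 tends to ['D_v ('D_v f) z], assumed positive; taking this
   number itself as the tolerance already makes the quotient positive. *)
have [q q_gt0 qP] : exists2 q : R, 0 < q & forall h, `|h| < q -> h != 0 ->
    0 < h^-1 * g' h.
  apply: near0_norm.
  have : derivable ('D_v f) (0 *: v + z) v by rewrite scale0r add0r.
  move=> /is_derive_line[]; rewrite -/g' => dg' Dg'.
  rewrite scale0r add0r in Dg'.
  move: dg'; rewrite /derivable => /cvgrPdist_lt.
  rewrite -[lim _]/('D_1 g' 0) Dg' => /(_ _ c_gt0).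
  rewrite near_withinE; apply: filterS => h /= + h0 => /(_ h0).
  by rewrite g'0 subr0 addr0 [h%:A]mulr1 ltr_distlC subrr => /andP[].
pose k := Num.min r q / 2.
have m_gt0 : 0 < Num.min r q by rewrite lt_min r_gt0.
have k_gt0 : 0 < k by rewrite divr_gt0.
have kr : k < r by rewrite (@lt_le_trans _ _ (Num.min r q))// ?ge_min ?lexx// /k; lra.
have kq : k < q.
  by rewrite (@lt_le_trans _ _ (Num.min r q))// ?ge_min ?lexx ?orbT// /k; lra.
have H1 (h : R) : h \in `]0, k[%R -> is_derive h 1 g (g' h).
  rewrite in_itv /= => /andP[h0 hk].
  by apply: dg; rewrite gtr0_norm// (lt_trans hk).
have H2 : {within `[0, k], continuous g}.
  apply: derivable_within_continuous => h; rewrite in_itv /= => /andP[h0 hk].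
  by have [] // := dg h; rewrite ger0_norm// (le_lt_trans hk).
have [h + E] := MVT k_gt0 H1 H2.
rewrite in_itv /= => /andP[h0 hk].
have g'h : 0 < g' h.
  have := qP h; rewrite gtr0_norm// gt_eqF// => /(_ (lt_trans hk kq) isT).
  by rewrite pmulr_rgt0 ?invr_gt0.
have : 0 < g k - g 0 by rewrite E subr0 mulr_gt0.
have [] := gP k; first by rewrite gtr0_norm.
lra.
Qed.


(* Mean value theorem in the direction [v], applied to [f (_ + h *: w) - f]. *)
Lemma second_difference f z v w :
  (\forall y \near z, derivable f y v) -> differentiable ('D_v f) z ->
  forall e : R, 0 < e -> \forall h \near 0^'+,
  `|f (h *: v + h *: w + z) - f (h *: v + z) - f (h *: w + z) + f z
    - h ^+ 2 * 'D_w ('D_v f) z| <= e * h ^+ 2.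
Proof.
move=> df d2f e e_gt0.
(* Two Taylor remainders will contribute at most [h * e / N] times [2 |v| + |w|], hence the factor
   2; the summand 1 keeps [N] positive when [v = w = 0]. *)
pose N := 2 * (`|v| + `|w|) + 1.
have N_gt0 : 0 < N by rewrite /N; have := normr_ge0 v; have := normr_ge0 w; lra.
pose G := 'D_v f.
have [r /= r_gt0 rP] : exists2 r : R, 0 < r & forall k : V, `|k| < r ->
    derivable f (k + z) v /\ `|G (k + z) - (G z + 'd G z k)| <= e / N * `|k|.
  have eN : 0 < e / N by rewrite divr_gt0.
  have H1 : \forall k \near (0 : V), derivable f (k + z) v.
    by move: df; rewrite (near_shift 0); apply: filterS => k /=; rewrite subr0.
  have := diff_locally d2f => /eqaddoP /(_ _ eN) H2.
  by apply: near0_norm; exact: filterI H1 H2.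
have NN : `|v| + `|w| < N by rewrite /N; have := normr_ge0 v; have := normr_ge0 w; lra.
near=> h.
have h_gt0 : 0 < h by [].
have hr : h < r / N by near: h; exact/nbhs_right_lt/divr_gt0.
have small (k : R) : 0 <= k <= h ->
    `|k *: v| <= h * `|v| /\ `|h *: w + k *: v| <= h * (`|v| + `|w|).
  move=> /andP[k0 kh].
  have A : `|k *: v| <= h * `|v| by rewrite normrZ ger0_norm// ler_wpM2r.
  split => //; rewrite (le_trans (ler_normD _ _))// mulrDr addrC lerD//.
  by rewrite normrZ gtr0_norm.
have hNr : h * N < r by rewrite -ltr_pdivlMr.
have small' (k : R) : 0 <= k <= h -> `|k *: v| < r /\ `|h *: w + k *: v| < r.
  move=> /small[A B]; have : h * (`|v| + `|w|) < r.
    by rewrite (lt_trans _ hNr)// ltr_pM2l.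
  split; last lra.
  have : 0 <= h * `|w| by rewrite mulr_ge0// ltW.
  lra.
(* The second difference is [phi h - phi 0], so it equals [h * phi' k] for some [k] between 0 and
   [h]. *)
pose phi (k : R) : R := f (k *: v + (h *: w + z)) - f (k *: v + z).
pose phi' (k : R) : R := G (k *: v + (h *: w + z)) - G (k *: v + z).
have dphi (k : R) : 0 <= k <= h -> is_derive k 1 phi (phi' k).
  move=> /small'[/rP[A _] /rP[B _]].
  apply: is_deriveB; apply: is_derive_line; last exact: A.
  by rewrite addrCA addrA.
have H1 (k : R) : k \in `]0, h[%R -> is_derive k 1 phi (phi' k).
  by rewrite in_itv /= => /andP[? ?]; apply: dphi; rewrite !ltW.
have H2 : {within `[0, h], continuous phi}.
  apply: derivable_within_continuous => k; rewrite in_itv /= => /dphi[].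
  by [].
have [k + E] := MVT h_gt0 H1 H2.
rewrite in_itv /= => /andP[/ltW k0 /ltW kh].
have kk : 0 <= k <= h by rewrite k0.
rewrite (_ : _ + f z = phi h - phi 0); last first.
  rewrite /phi scale0r !add0r addrA opprB !addrA; lra.
rewrite E subr0 deriveE// mulrC -mulrA -mulrBr normrM gtr0_norm// [e * _]mulrCA ler_pM2l//.
have [/rP[_ A] /rP[_ B]] := small' _ kk.
have [A' B'] := small _ kk.
move: A B; rewrite !linearD !linearZ /=.
have -> : h *: w + k *: v + z = k *: v + (h *: w + z) by rewrite addrCA addrA.
(* [X] and [Y] are the first-order Taylor remainders of ['D_v f] at the two points entering [phi'].
   In [Y - X] the contributions of [k *: v] cancel, leaving [phi' k] minus [h] times the derivative
   of ['D_v f] along [w]. *)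
set X := (X in `|X| <= _ -> _); set Y := (Y in _ -> `|Y| <= _ -> _) => HX HY.
rewrite (_ : phi' k + _ = Y - X); last first.
  by rewrite /phi' /X /Y; set a := 'd G z v; set b := 'd G z w; rewrite -/b /GRing.scale /=; ring.
rewrite (le_trans (ler_normB _ _))//.
have eN : 0 < e / N by rewrite divr_gt0.
have {}HX : `|X| <= e / N * (h * `|v|) by rewrite (le_trans HX)// ler_pM2l.
have {}HY : `|Y| <= e / N * (h * (`|v| + `|w|)) by rewrite (le_trans HY)// ler_pM2l.
rewrite (le_trans (lerD HY HX))// -mulrDr -mulrDr mulrAC -mulrA ler_pM2l//.
rewrite [X in _ <= X](_ : _ = h * N / N); last by rewrite mulfK ?gt_eqF.
rewrite ler_pM2r ?invr_gt0// ler_pM2l// /N; have := normr_ge0 w; lra.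
Unshelve. all: by end_near. Qed.


Lemma distr_scaled_le (p k x y d : R) :
  `|p - k * x| <= d / 2 * k -> `|p - k * y| <= d / 2 * k ->
  `|k * (x - y)| <= d * k.
Proof.
by rewrite !ler_norml => /andP[? ?] /andP[? ?]; apply/andP; split; lra.
Qed.

(** Divided by [h ^+ 2], one and the same second difference, symmetric in [v] and [w], tends to both
    mixed derivatives. Differentiability of the first derivatives is asked at [z] alone, in the form
    that [twice_differentiable_on] provides. *)
Lemma derive_swap f z v w :
  (\forall y \near z, derivable f y v) -> (\forall y \near z, derivable f y w) ->
  differentiable ('D_v f) z -> differentiable ('D_w f) z ->
  'D_w ('D_v f) z = 'D_v ('D_w f) z.
Proof.
move=> dv dw dDv dDw; apply/eqP; rewrite -subr_eq0 -normr_eq0 eq_le normr_ge0 andbT.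
apply/ler_addgt0Pr => e e_gt0; rewrite add0r.
have e2 : 0 < e / 2 by rewrite divr_gt0.
have A := second_difference w dv dDv e2; have B := second_difference v dw dDw e2.
have [h [h_gt0 [{}A {}B]]] := filter_ex (filterI (nbhs_right_gt (0 : R)) (filterI A B)).
pose P := f (h *: v + h *: w + z) - f (h *: v + z) - f (h *: w + z) + f z.
have {}B : `|P - h ^+ 2 * 'D_v ('D_w f) z| <= e / 2 * h ^+ 2.
  have -> : P = f (h *: w + h *: v + z) - f (h *: w + z) - f (h *: v + z) + f z.
    by rewrite /P [h *: v + h *: w]addrC; ring.
  exact: B.
have {}A : `|P - h ^+ 2 * 'D_w ('D_v f) z| <= e / 2 * h ^+ 2 by exact: A.
have h2 : 0 < h ^+ 2 by rewrite exprn_gt0.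
have := distr_scaled_le A B.
by rewrite normrM gtr0_norm// mulrC ler_pM2r.
Qed.

(** Convexity bounds the difference quotient with step [h] in (0, 1) by the full increment; letting
    [h] decrease to 0 gives the claim. *)
Lemma convex_tangent (D : set V) f z v :
  strictly_convex_on D f -> D z -> D (v + z) -> derivable f z v ->
  'D_v f z <= f (v + z) - f z.
Proof.
move=> cvx Dz Dvz df.
have [v0|v0] := eqVneq v 0; first by rewrite v0 derive0 add0r subrr.
have key : \forall h \near 0^'+, h^-1 *: ((f \o shift z) (h *: v) - f z) <= f (v + z) - f z.
  near=> h.
  have h0 : 0 < h by [].
  have h1 : h < 1 by near: h; exact: nbhs_right_lt.
  have vz : v + z != z by rewrite -subr_eq0 addrK.
  have := cvx _ _ h Dvz Dz vz; rewrite h0 h1 => /(_ isT).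
  rewrite scalerDr -addrA -scalerDl subrKC scale1r => H.
  by rewrite /GRing.scale /= mulrC ler_pdivrMr//; lra.
have cv : h^-1 *: ((f \o shift z) (h *: v) - f z) @[h --> 0^'+] --> 'D_v f z.
  by apply: cvg_dnbhs_at_right; exact: df.
have <- := cvg_lim (@norm_hausdorff _ _) cv.
by apply: limr_le; [apply/cvg_ex; eexists; exact: cv|].
Unshelve. all: by end_near. Qed.

End Calculus.

(** * Differentiation rules for directional derivatives *)

Section Rules.
Context {R : realType} {V : normedModType R}.
Implicit Types (f g a b : V -> R) (z v w : V).

Lemma is_derive_linear f z v :
  (forall h y y', f (h *: y + y') = h * f y + f y') -> is_derive z v f (f v).
Proof.
move=> lin.
have E : \forall h \near (0 : R)^',
    h^-1 *: ((f \o shift z) (h *: v) - f z) = f v.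
  near=> h; rewrite /= lin addrK /GRing.scale /= mulKf//.
  by near: h; exact: nbhs_dnbhs_neq.
by split; [apply: is_cvg_near_cst E | apply: lim_near_cst E].
Unshelve. all: by end_near. Qed.

Lemma is_derive_mul a b z v (da db : R) :
  is_derive z v a da -> is_derive z v b db ->
  is_derive z v (fun y => a y * b y) (da * b z + a z * db).
Proof.
move=> Da Db; have := is_deriveM Da Db.
by rewrite addrC [_ *: da]mulrC.
Qed.

Lemma is_derive_inv a z v (da : R) : a z != 0 ->
  is_derive z v a da -> is_derive z v (fun y => (a y)^-1) (- da / a z ^+ 2).
Proof.
move=> az [Da <-]; split; first exact: derivableV.
by rewrite deriveV// /GRing.scale /= mulNr mulrC mulNr.
Qed.

Lemma is_derive_add a b z v (da db : R) :
  is_derive z v a da -> is_derive z v b db ->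
  is_derive z v (fun y => a y + b y) (da + db).
Proof. exact: is_deriveD. Qed.

Lemma is_derive_sub a b z v (da db : R) :
  is_derive z v a da -> is_derive z v b db ->
  is_derive z v (fun y => a y - b y) (da - db).
Proof. exact: is_deriveB. Qed.

Lemma is_derive_opp a z v (da : R) :
  is_derive z v a da -> is_derive z v (fun y => - a y) (- da).
Proof. exact: is_deriveN. Qed.

Lemma is_derive_const (c : R) z v : is_derive z v (fun=> c) 0.
Proof. exact: is_derive_cst. Qed.

Lemma is_derive_scale (c : R) a z v (da : R) :
  is_derive z v a da -> is_derive z v (fun y => c * a y) (c * da).
Proof. exact: is_deriveZ. Qed.

Lemma is_derive_bigsum n (h : 'I_n -> V -> R) z v (dh : 'I_n -> R) :
  (forall i, is_derive z v (h i) (dh i)) ->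
  is_derive z v (fun y => \sum_i h i y) (\sum_i dh i).
Proof.
move=> H; have -> : (fun y => \sum_i h i y) = \sum_i h i.
  by apply/funext => y; rewrite fct_sumE.
exact: is_derive_sum.
Qed.

(** A chain rule with [a] and [b] derivable only along [v]: on the line through [z] derivability is
    differentiability, so the composition theorem for differentials applies to [G \o phi]. *)
Lemma is_derive_comp2 (G : R * R -> R) a b z v (da db : R) :
  differentiable G (a z, b z) ->
  is_derive z v a da -> is_derive z v b db ->
  is_derive z v (fun y => G (a y, b y))
    ('D_(1, 0) G (a z, b z) * da + 'D_(0, 1) G (a z, b z) * db).
Proof.
move=> dG [Da <-] [Db <-].
have z0 : 0 *: v + z = z by rewrite scale0r add0r.
pose al (h : R) := a (h *: v + z); pose be (h : R) := b (h *: v + z).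
have Ga : differentiable al 0.
  by apply/derivable1_diffP; exact: (iffLR (derivable1P a z v) Da).
have Gb : differentiable be 0.
  by apply/derivable1_diffP; exact: (iffLR (derivable1P b z v) Db).
have line (c : V -> R) : derivable c z v ->
    'D_v c z = 'D_1 (fun h : R => c (h *: v + z)) 0.
  by move=> Dc; have := @is_derive_line _ _ c z v 0; rewrite z0 => /(_ Dc)[_ <-].
pose phi h := (al h, be h).
have dphi : differentiable phi 0 by exact: differentiable_pair.
have phi0 : phi 0 = (a z, b z) by rewrite /phi /al /be z0.
have dGphi : differentiable (G \o phi) 0.
  by apply: differentiable_comp; rewrite ?phi0.
have D : derivable (fun y => G (a y, b y)) z v.
  by apply/derivable1P; apply/derivable1_diffP; exact: dGphi.
split=> //; rewrite (line _ D) (line _ Da) (line _ Db).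
have dphiE : 'd phi 0 1 = ('D_1 al 0, 'D_1 be 0).
  by rewrite (diff_pair Ga Gb) !deriveE.
have -> : 'D_1 (fun h : R => G (a (h *: v + z), b (h *: v + z))) 0 =
    'd G (a z, b z) ('D_1 al 0, 'D_1 be 0).
  by rewrite -dphiE -phi0 -[RHS]/(('d G (phi 0) \o 'd phi 0) 1) -diff_comp ?phi0// -deriveE.
rewrite -/al -/be.
set x := 'D_1 al 0; set y := 'D_1 be 0.
have -> : (x, y) = x *: ((1, 0) : R * R) + y *: ((0, 1) : R * R).
  by apply: injective_projections; rewrite /= /GRing.scale /= mulr0 mulr1 ?addr0 ?add0r.
rewrite !deriveE// linearD !linearZ /=.
by congr (_ + _); exact: mulrC.
Qed.

End Rules.

(** * Closure properties of twice differentiable functions on an open set *)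

Section TwiceDifferentiable.
Context {R : realType} {V : normedModType R}.
Variable (O : set V).
Hypothesis openO : open O.
Implicit Types (f g a b : V -> R) (z v w : V).
Local Notation td := (twice_differentiable_on O).

Lemma near_open (P : V -> Prop) z :
  O z -> (forall y, O y -> P y) -> \forall y \near z, P y.
Proof.
by move=> Oz OP; apply: filterS OP _; exact: open_nbhs_nbhs.
Qed.

Lemma near_open_derive f g z v :
  O z -> (forall y, O y -> f y = g y) -> 'D_v f z = 'D_v g z.
Proof. by move=> Oz fg; apply: near_eq_derive; exact: near_open fg. Qed.

Lemma twice_differentiableW f z v : td f -> O z -> is_derive z v f ('D_v f z).
Proof. by move=> tf /tf[df _]; split=> //; exact: diff_derivable. Qed.

Lemma twice_differentiable_derivable2 f z v w :
  td f -> O z -> derivable ('D_v f) z w.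
Proof. by move=> tf /tf[_ df]; exact: diff_derivable. Qed.

(** Since [O] is open, a formula [g v] for the first derivatives coincides with ['D_v f] near each
    point and transfers its differentiability. The closure rules below rest on this. *)
Lemma twice_differentiable_intro f (g : V -> V -> R) :
  (forall z, O z -> differentiable f z) ->
  (forall v z, O z -> 'D_v f z = g v z) ->
  (forall v z, O z -> differentiable (g v) z) -> td f.
Proof.
move=> df fg dg z Oz; split; first exact: df.
move=> v; apply: (near_eq_differentiable (f := g v)); last exact: dg.
by apply: near_open => // y Oy; rewrite fg.
Qed.

Lemma twice_differentiable_eq f g : (forall z, O z -> f z = g z) -> td f -> td g.
Proof.
move=> fg tf; apply: (twice_differentiable_intro (g := fun v => 'D_v f)).
- move=> z Oz; apply: (near_eq_differentiable (f := f)); last by case: (tf _ Oz).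
  exact: near_open fg.
- by move=> v z Oz; apply: near_open_derive => // y Oy; rewrite fg.
- by move=> v z Oz; case: (tf _ Oz).
Qed.

Lemma twice_differentiable_cst (c : R) : td (fun=> c).
Proof.
apply: (twice_differentiable_intro (g := fun _ _ => 0)) => [z _|v z _|v z _].
- exact: differentiable_cst.
- by have [_ ->] := is_derive_const c z v.
- exact: differentiable_cst.
Qed.

Lemma twice_differentiable_add a b : td a -> td b -> td (fun y => a y + b y).
Proof.
move=> ta tb.
apply: (twice_differentiable_intro (g := fun v y => 'D_v a y + 'D_v b y)) => [z|v z|v z] Oz;
  have [da d2a] := ta _ Oz; have [db d2b] := tb _ Oz.
- exact: differentiableD.
- by have [_ ->] := is_derive_add (twice_differentiableW v ta Oz) (twice_differentiableW v tb Oz).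
- exact: differentiableD.
Qed.

Lemma twice_differentiable_mul a b : td a -> td b -> td (fun y => a y * b y).
Proof.
move=> ta tb.
apply: (twice_differentiable_intro (g := fun v y => 'D_v a y * b y + a y * 'D_v b y))
  => [z|v z|v z] Oz; have [da d2a] := ta _ Oz; have [db d2b] := tb _ Oz.
- exact: differentiableM.
- by have [_ ->] := is_derive_mul (twice_differentiableW v ta Oz) (twice_differentiableW v tb Oz).
- by apply: (@differentiableD _ _ _ (fun y => 'D_v a y * b y) (fun y => a y * 'D_v b y));
    exact: differentiableM.
Qed.

Lemma twice_differentiable_scale (c : R) a : td a -> td (fun y => c * a y).
Proof. by apply: twice_differentiable_mul; exact: twice_differentiable_cst. Qed.

Lemma twice_differentiable_sub a b : td a -> td b -> td (fun y => a y - b y).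
Proof.
move=> ta tb; have := twice_differentiable_add ta (twice_differentiable_scale (-1) tb).
by apply: twice_differentiable_eq => z _; rewrite mulN1r.
Qed.

Lemma twice_differentiable_sum n (h : 'I_n -> V -> R) :
  (forall i, td (h i)) -> td (fun y => \sum_i h i y).
Proof.
move=> th; suff H (s : seq 'I_n) : td (fun y => \sum_(i <- s) h i y) by exact: H.
elim: s => [|i s IH].
  by apply: twice_differentiable_eq (twice_differentiable_cst 0) => z _; rewrite big_nil.
have := twice_differentiable_add (th i) IH.
by apply: twice_differentiable_eq => z _; rewrite big_cons.
Qed.

Lemma twice_differentiable_inv a :
  (forall z, O z -> a z != 0) -> td a -> td (fun y => (a y)^-1).
Proof.
move=> a0 ta.
(* The derivative is written as a product of inverses, so that the product rule gives its
   differentiability. *)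
apply: (twice_differentiable_intro (g := fun v y => 'D_v a y * (- (a y)^-1 * (a y)^-1)))
  => [z|v z|v z] Oz; have [da d2a] := ta _ Oz.
- by apply: differentiableV => //; exact: a0.
- have [_ ->] := is_derive_inv (a0 _ Oz) (twice_differentiableW v ta Oz).
  by rewrite expr2 invfM !mulNr mulrN.
- have dV : differentiable (fun y => (a y)^-1) z by apply: differentiableV => //; exact: a0.
  apply: (@differentiableM _ _ ('D_v a) (fun y => - (a y)^-1 * (a y)^-1)) => //.
  apply: (@differentiableM _ _ (fun y => - (a y)^-1) (fun y => (a y)^-1)) => //.
  exact: differentiableN.
Qed.

Lemma twice_differentiable_comp1 (G : R -> R) a :
  (forall x, derivable G x 1) -> (forall x, derivable (derive1 G) x 1) ->
  td a -> td (fun y => G (a y)).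
Proof.
move=> dG d2G ta.
have dG' x : differentiable G x by exact/derivable1_diffP.
apply: (twice_differentiable_intro (g := fun v y => 'D_v a y * derive1 G (a y)))
  => [z|v z|v z] Oz; have [da d2a] := ta _ Oz.
- exact: (@differentiable_comp _ _ _ _ a G).
- rewrite deriveE; last exact: (@differentiable_comp _ _ _ _ a G).
  by rewrite (@diff_comp _ _ _ _ a G)//= -(deriveE v da) diff1E.
- apply: (@differentiableM _ _ ('D_v a) (fun y => derive1 G (a y))) => //.
  by apply: (@differentiable_comp _ _ _ _ a (derive1 G)) => //; exact/derivable1_diffP.
Qed.

Lemma twice_differentiable_comp2 (Q : set (R * R)) (G : R * R -> R) a b :
  twice_differentiable_on Q G -> (forall z, O z -> Q (a z, b z)) ->
  td a -> td b -> td (fun y => G (a y, b y)).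
Proof.
move=> tG Qab ta tb.
apply: (twice_differentiable_intro (g := fun v y => 'D_(1, 0) G (a y, b y) * 'D_v a y
   + 'D_(0, 1) G (a y, b y) * 'D_v b y)) => [z|v z|v z] Oz; have [dG d2G] := tG _ (Qab _ Oz);
  have [da d2a] := ta _ Oz; have [db d2b] := tb _ Oz.
- by apply: (@differentiable_comp _ _ _ _ (fun y => (a y, b y)) G) => //; exact: differentiable_pair.
- by have [_ ->] := is_derive_comp2 dG (twice_differentiableW v ta Oz) (twice_differentiableW v tb Oz).
- have dab : differentiable (fun y => (a y, b y)) z by exact: differentiable_pair.
  apply: (@differentiableD _ _ _ (fun y => 'D_(1, 0) G (a y, b y) * 'D_v a y)
      (fun y => 'D_(0, 1) G (a y, b y) * 'D_v b y)).
    apply: (@differentiableM _ _ (fun y => 'D_(1, 0) G (a y, b y)) ('D_v a)) => //.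
    exact: (@differentiable_comp _ _ _ _ (fun y => (a y, b y)) ('D_(1, 0) G)).
  apply: (@differentiableM _ _ (fun y => 'D_(0, 1) G (a y, b y)) ('D_v b)) => //.
  exact: (@differentiable_comp _ _ _ _ (fun y => (a y, b y)) ('D_(0, 1) G)).
Qed.

End TwiceDifferentiable.

(** * Pointwise algebra of the entropy balance *)

Section EntropyBalance.
Context {K : realFieldType} {d : nat}.
Variables (mu rho e p E F Fr Fe : K) (u B : 'I_d -> K).
Hypothesis mu_neq0 : mu != 0.

Let b := (2 * mu)^-1 * \sum_i B i ^+ 2.
Let kin := 2^-1 * \sum_i u i ^+ 2.
Hypothesis energyE : E = rho * e + rho * kin + b.
Hypothesis pressureE : p * Fe = - rho ^+ 2 * Fr.

(* A suffix [x] or [t] marks a derivative in space or time: [ux i j] stands for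
   [d_j u_i].  The factors [rho * u j] are the components of the momentum. *)

Lemma energy_flux_balance (j : 'I_d) (rx ex px Ex : K) (ux Bx mx : 'I_d -> K) :
  (forall i, mx i = u i * rx + rho * ux i) ->
  rho * ex = Ex - mu^-1 * (\sum_i B i * Bx i) - \sum_i u i * mx i
             + (kin - e) * rx ->
  let bx := mu^-1 * \sum_i B i * Bx i in
  ((Ex + px + bx) * u j + (E + p + b) * ux j
   - (mu^-1 * (\sum_i (Bx i * u i + B i * ux i)) * B j
      + mu^-1 * (\sum_i B i * u i) * Bx j))
  - \sum_i u i * (ux i * (rho * u j) + u i * mx j
       - mu^-1 * (Bx i * B j + B i * Bx j))
  - u j * (px + bx)
  + (kin - e) * mx j
  - mu^-1 * \sum_i B i * ((Bx i * u j + B i * ux j) - (ux i * B j + u i * Bx j))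
  = rho * ex * u j + p * ux j + mu^-1 * (\sum_i B i * u i) * Bx j.
Proof.
move=> mxE exE bx; rewrite /bx exE.
have -> : \sum_i u i * mx i = rx * (\sum_i u i ^+ 2) + rho * \sum_i u i * ux i.
  by rewrite !mulr_sumr -big_split /=; apply: eq_bigr => i _; rewrite mxE; ring.
have -> : \sum_i (Bx i * u i + B i * ux i) =
    \sum_i Bx i * u i + \sum_i B i * ux i by rewrite big_split.
have -> : \sum_i u i * (ux i * (rho * u j) + u i * mx j
      - mu^-1 * (Bx i * B j + B i * Bx j)) =
    rho * u j * (\sum_i u i * ux i) + mx j * (\sum_i u i ^+ 2)
    + (- mu^-1 * B j) * (\sum_i Bx i * u i) + (- mu^-1 * Bx j) * \sum_i B i * u i.
  by rewrite !mulr_sumr -!big_split /=; apply: eq_bigr => i _; ring.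
have -> : \sum_i B i * ((Bx i * u j + B i * ux j) - (ux i * B j + u i * Bx j)) =
    u j * (\sum_i B i * Bx i) + ux j * (\sum_i B i ^+ 2)
    + (- B j) * (\sum_i B i * ux i) + (- Bx j) * \sum_i B i * u i.
  by rewrite !mulr_sumr -!big_split /=; apply: eq_bigr => i _; ring.
rewrite mxE energyE /b /kin.
set N := \sum_i u i ^+ 2; set BB := \sum_i B i ^+ 2; set Q := \sum_i u i * ux i.
set BBx := \sum_i B i * Bx i; set Bu := \sum_i B i * u i.
set X := \sum_i Bx i * u i; set Y := \sum_i B i * ux i.
by field.
Qed.

(** Energy minus [u] times momentum, plus [kin - e] times mass, minus [mu^-1 * B] times induction,
    is the balance of internal energy, with [rho (e_t + u . grad e) + p div u] on the left, up to
    the term [mu^-1 (B . u) div B]. Adding [Fe] times this to [F + rho Fr] times mass gives the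
    entropy balance, since [pressureE] cancels the terms [p Fe div u] and [rho^2 Fr div u]. *)
Lemma entropy_balance (rt et Et a w : K) (mt Bt c : 'I_d -> K)
    (rx ex px Ex : 'I_d -> K) (ux Bx mx : 'I_d -> 'I_d -> K) :
  (forall i j, mx i j = u i * rx j + rho * ux i j) ->
  (forall j, rho * ex j = Ex j - mu^-1 * (\sum_i B i * Bx i j)
      - \sum_i u i * mx i j + (kin - e) * rx j) ->
  rho * et = Et - mu^-1 * (\sum_i B i * Bt i) - \sum_i u i * mt i
      + (kin - e) * rt ->
  let bx j := mu^-1 * \sum_i B i * Bx i j in
  rt + \sum_j mx j j = a ->
  (forall i, mt i + (\sum_j (ux i j * (rho * u j) + u i * mx j j
       - mu^-1 * (Bx i j * B j + B i * Bx j j)) + (px i + bx i)) = c i) ->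
  Et + \sum_j ((Ex j + px j + bx j) * u j + (E + p + b) * ux j j
     - (mu^-1 * (\sum_i (Bx i j * u i + B i * ux i j)) * B j
        + mu^-1 * (\sum_i B i * u i) * Bx j j)) = w ->
  (forall i, Bt i + \sum_j ((Bx i j * u j + B i * ux j j)
      - (ux i j * B j + u i * Bx j j)) = 0) ->
  \sum_j Bx j j = 0 ->
  (rt * F + rho * (Fr * rt + Fe * et))
  + \sum_j ((rx j * F + rho * (Fr * rx j + Fe * ex j)) * u j + rho * F * ux j j)
  = (F + rho * Fr + Fe * (kin - e)) * a - Fe * (\sum_i u i * c i) + Fe * w.
Proof.
move=> mxE exE etE bx mass mom en ind divB.
have energy : rho * et + \sum_j (rho * ex j * u j + p * ux j j) =
    w - \sum_i u i * c i + (kin - e) * a.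
  (* Adding a multiple of [div B = 0] produces the summand that [energy_flux_balance] yields in each
     direction. *)
  have -> : \sum_j (rho * ex j * u j + p * ux j j) =
      \sum_j (rho * ex j * u j + p * ux j j + mu^-1 * (\sum_i B i * u i) * Bx j j).
    by rewrite [RHS]big_split /= -mulr_sumr divB mulr0 addr0.
  (* The induction equation has zero right-hand side, so its product with [mu^-1 * B] can be
     subtracted freely. *)
  transitivity (w - \sum_i u i * c i + (kin - e) * a
      - mu^-1 * \sum_i B i * (Bt i + \sum_j ((Bx i j * u j + B i * ux j j)
          - (ux i j * B j + u i * Bx j j)))); last first.
    by rewrite [\sum_i B i * _]big1 ?mulr0 ?subr0// => i _; rewrite ind mulr0.
  rewrite -en -mass.
  have -> : \sum_i u i * c i = \sum_i u i * mt i
      + \sum_j (\sum_i u i * (ux i j * (rho * u j) + u i * mx j j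
          - mu^-1 * (Bx i j * B j + B i * Bx j j)) + u j * (px j + bx j)).
    rewrite [X in _ + X]big_split /= exchange_big -!big_split /=.
    by apply: eq_bigr => i _; rewrite -mom -mulr_sumr -!mulrDr.
  have -> : \sum_i B i * (Bt i + \sum_j ((Bx i j * u j + B i * ux j j)
      - (ux i j * B j + u i * Bx j j))) = \sum_i B i * Bt i + \sum_j \sum_i
        B i * ((Bx i j * u j + B i * ux j j) - (ux i j * B j + u i * Bx j j)).
    rewrite exchange_big -!big_split /=.
    by apply: eq_bigr => i _; rewrite -mulr_sumr -!mulrDr.
  have -> : \sum_j (rho * ex j * u j + p * ux j j + mu^-1 * (\sum_i B i * u i) * Bx j j) =
    \sum_j ((Ex j + px j + bx j) * u j + (E + p + b) * ux j j
     - (mu^-1 * (\sum_i (Bx i j * u i + B i * ux i j)) * B j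
        + mu^-1 * (\sum_i B i * u i) * Bx j j))
    + (-1) * \sum_j (\sum_i u i * (ux i j * (rho * u j) + u i * mx j j
          - mu^-1 * (Bx i j * B j + B i * Bx j j)) + u j * (px j + bx j))
    + (kin - e) * (\sum_j mx j j)
    + (- mu^-1) * \sum_j \sum_i
        B i * ((Bx i j * u j + B i * ux j j) - (ux i j * B j + u i * Bx j j)).
    rewrite [(-1) * _]mulr_sumr [(kin - e) * (\sum_j _)]mulr_sumr.
    rewrite [- mu^-1 * (\sum_j \sum_i _)]mulr_sumr -!big_split /=.
    apply: eq_bigr => j _.
    have /= <- := energy_flux_balance j (px j) (fun i => mxE i j) (exE j).
    by rewrite /bx; ring.
  by rewrite etE; ring.
have -> : \sum_j ((rx j * F + rho * (Fr * rx j + Fe * ex j)) * u j + rho * F * ux j j) =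
    (F + rho * Fr) * (\sum_j mx j j)
    + Fe * (\sum_j (rho * ex j * u j + p * ux j j)).
  rewrite !mulr_sumr -big_split /=; apply: eq_bigr => j _.
  have -> : Fe * (rho * ex j * u j + p * ux j j) =
     Fe * rho * ex j * u j + p * Fe * ux j j by ring.
  by rewrite pressureE mxE; ring.
rewrite -mass.
have -> : Fe * w = Fe * (rho * et + \sum_j (rho * ex j * u j + p * ux j j))
   + Fe * (\sum_i u i * c i) - Fe * (kin - e) * (rt + \sum_j mx j j).
  by rewrite energy -mass; ring.
by ring.
Qed.

End EntropyBalance.

(** * Regularity in space-time and conservation of the divergence *)

Section SpaceTimeCalculus.
Context {R : realType} {d : nat}.
Local Notation V := (R * 'cV[R]_d)%type.
Implicit Types (f g : V -> R) (z v : V).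

(** The equations hold on [open_slab], where derivatives see a full neighbourhood; [slab] adds the
    initial time, at which [div B = 0] is prescribed. *)
Definition open_slab (T : R) : set V := [set z | 0 < z.1 < T].
Definition slab (T : R) : set V := [set z | 0 <= z.1 < T].

Lemma open_open_slab T : open (open_slab T).
Proof.
have -> : open_slab T = fst @^-1` [set` `]0, T[%R].
  by apply/funext => z; apply/propext; rewrite /open_slab /= in_itv.
apply: open_comp => [z _|]; last exact: (@interval_open R (BRight 0) (BLeft T) isT isT).
exact: cvg_fst.
Qed.

Lemma smooth_on_twice_differentiable T f :
  smooth_on (slab T) f -> twice_differentiable_on (open_slab T) f.
Proof.
case=> O [g [oO sO fg gk]].
have sub z : open_slab T z -> slab T z by move=> /andP[z0 zT]; rewrite /slab /= ltW.
apply: (twice_differentiable_eq (@open_open_slab T) (f := g)) => [z /sub/fg //|z /sub/sO Oz].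
have [dg d2g] := gk 2%N.
by split=> [|v]; [exact: dg|have [+ _] := d2g v; exact].
Qed.

(** At the initial time a field and its smooth extension are only known to agree for [t >= 0]; a
    line in a spatial direction stays in the slab, so agreement along it is enough. *)
Lemma derive_eq_line f g z v :
  (forall h : R, f (h *: v + z) = g (h *: v + z)) -> 'D_v f z = 'D_v g z.
Proof.
move=> fg; rewrite /derive.
suff -> : (fun h : R => h^-1 *: ((f \o shift z) (h *: v) - f z)) =
          (fun h : R => h^-1 *: ((g \o shift z) (h *: v) - g z)) by [].
apply/funext => h /=; rewrite fg.
by have := fg 0; rewrite scale0r add0r => ->.
Qed.

(* [d_t div B = - sum_jk d_j d_k A_jk], which vanishes by antisymmetry of [A].  At
   [t = 0] only the spatial derivatives of [B] are those of its smooth extension. *)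
Lemma divergence_free_preserved T (B : V -> 'cV[R]_d) (A : V -> 'M[R]_d) :
  (forall i, smooth_on (slab T) (fun z => B z i 0)) ->
  (forall i j, twice_differentiable_on (open_slab T) (fun z => A z i j)) ->
  (forall z i j, A z i j = - A z j i) ->
  (forall z, open_slab T z -> dtv B z + divm A z = 0) ->
  (forall x, div B (0, x) = 0) ->
  forall t x, 0 < t < T -> div B (t, x) = 0.
Proof.
move=> smB tA antiA eqB div0 t x /andP[t0 tT].
have tB i := smooth_on_twice_differentiable (smB i).
have oO := @open_open_slab T.
pose e (j : 'I_d) : V := (0, delta_mx j 0).
have ddiv z : open_slab T z -> is_derive z (1, 0) (div B) 0.
  move=> Oz.
  have dtB j y : open_slab T y ->
      'D_(1, 0) (fun y => B y j 0) y = - \sum_k 'D_(e k) (fun y => A y j k) y.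
    move=> /eqB /(congr1 (fun M : 'cV[R]_d => M j 0)).
    by rewrite !mxE => /eqP; rewrite addr_eq0 => /eqP.
  have swap (f : V -> R) v w : twice_differentiable_on (open_slab T) f ->
      'D_w ('D_v f) z = 'D_v ('D_w f) z.
    move=> tf; have [_ d2f] := tf _ Oz.
    by apply: derive_swap => //; apply: (near_open oO) => // y Oy;
      have [df _] := tf _ Oy; exact: diff_derivable.
  have D j : is_derive z (1, 0) (dx j (fun y => B y j 0))
      (- \sum_k 'D_(e j) ('D_(e k) (fun y => A y j k)) z).
    split; first by have [_ d2f] := tB j _ Oz; apply: diff_derivable; exact: (d2f (e j)).
    rewrite -[dx j _]/('D_(e j) _) swap// (near_open_derive oO _ Oz (dtB j)).
    have [_ ->//] := is_derive_opp (is_derive_bigsum (fun k => derivableP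
      (twice_differentiable_derivable2 (v := e k) (w := e j) (tA j k) Oz))).
  have := is_derive_bigsum D.
  rewrite sumrN; set X := (X in - X); suff -> : X = 0 by rewrite oppr0.
  (* Renaming [j] and [k], exchanging the order of the derivatives and using the antisymmetry of [A]
     turns [X] into [- X]. *)
  suff : X = - X by move/eqP; rewrite -subr_eq0 opprK -mulr2n mulrn_eq0 => /eqP.
  rewrite {1}/X exchange_big -sumrN; apply: eq_bigr => j _.
  rewrite -sumrN; apply: eq_bigr => k _; rewrite swap//.
  have -> : (fun y => A y k j) = (fun y => - A y j k).
    by apply/funext => y; exact: antiA.
  have E y : open_slab T y ->
      'D_(e k) (fun y => - A y j k) y = - 'D_(e k) (fun y => A y j k) y.
    by move=> Oy; have [_ ->] := is_derive_opp (twice_differentiableW (e k) (tA j k) Oy).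
  rewrite (near_open_derive oO _ Oz E).
  by have [_ ->] := is_derive_opp (derivableP
      (twice_differentiable_derivable2 (v := e k) (w := e j) (tA j k) Oz)).
(* The smooth extensions [g j] make the divergence along the time line through [x] continuous down
   to [t = 0], as the mean value theorem on [0, t] requires. *)
have /choice[g gP] : forall j, exists g : V -> R, forall z, slab T z ->
    B z j 0 = g z /\ differentiable ('D_(e j) g) z.
  move=> j.
  have [W [g [_ sO fg gk]]] := smB j; exists g => z Az; split; first exact: fg.
  by have [_ d2g] := gk 2%N; have [+ _] := d2g (e j); apply; exact: sO.
pose dg z := \sum_j 'D_(e j) (g j) z.
have dgE z : slab T z -> div B z = dg z.
  move=> Az; apply: eq_bigr => j _; apply: derive_eq_line => h.
  by have [] := gP j (h *: e j + z); rewrite // /slab /= scaler0 add0r.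
have online (s : R) : s *: ((1, 0) : V) + (0, x) = (s, x).
  by apply: injective_projections; rewrite /= ?addr0 ?scaler0 ?add0r// [_%:A]mulr1.
have derh (s : R) : 0 <= s <= t ->
    is_derive s 1 (fun s : R => dg (s *: ((1, 0) : V) + (0, x))) ('D_(1, 0) dg (s, x)).
  move=> /andP[s0 st]; have := @is_derive_line _ _ dg (0, x) (1, 0) s.
  rewrite online; apply.
  have As : slab T (s, x) by rewrite /slab /= s0 (le_lt_trans st).
  by have [] := is_derive_bigsum (fun j =>
    derivableP (diff_derivable (a := (s, x)) (v := (1, 0)) (gP j _ As).2)).
have H1 (s : R) : s \in `]0, t[%R ->
    is_derive s 1 (fun s : R => dg (s *: ((1, 0) : V) + (0, x))) 0.
  rewrite in_itv /= => /andP[s0 st].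
  have Os : open_slab T (s, x) by rewrite /open_slab /= s0 (lt_trans st).
  have := derh s; rewrite !ltW// => /(_ isT).
  have <- : 'D_(1, 0) (div B) (s, x) = 'D_(1, 0) dg (s, x).
    apply: (near_open_derive oO) => // y /andP[y0 yT]; apply: dgE.
    by rewrite /slab /= ltW.
  by have [_ ->] := ddiv _ Os.
have H2 : {within `[0, t], continuous (fun s : R => dg (s *: ((1, 0) : V) + (0, x)))}.
  by apply: derivable_within_continuous => s; rewrite in_itv /= => /derh[].
have [c _] := MVT t0 H1 H2.
rewrite mul0r !online => /eqP; rewrite subr_eq0 => /eqP E.
rewrite dgE; last by rewrite /slab /= ltW.
by rewrite E -dgE ?div0// /slab /= lexx (lt_trans t0).
Qed.

End SpaceTimeCalculus.

(** * Entropy and pressure as functions of density and internal energy *)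

Section Thermodynamics.
Context {R : realType}.
Variables (s : R -> R -> R) (f : R -> R).
Hypothesis law : entropy_law s.
Hypothesis df : forall x, derivable f x 1.
Hypothesis d2f : forall x, derivable (derive1 f) x 1.
Implicit Types p : R * R.

Lemma open_quadrant : open (@quadrant R).
Proof.
have -> : @quadrant R = (fst @^-1` [set x | 0 < x]) `&` (snd @^-1` [set x | 0 < x]).
  by apply/funext => p; apply/propext.
apply: openI.
  by apply: open_comp => [p _|]; [exact: cvg_fst|exact: open_gt].
by apply: open_comp => [p _|]; [exact: cvg_snd|exact: open_gt].
Qed.

(** Links the one-variable derivatives in [pressure] with the directional derivatives of the joint
    function, to which [entropy_regular] refers. *)
Lemma ds_drhoE r e : ds_drho s r e = 'D_(1, 0) (fun p => s p.1 p.2) (r, e).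
Proof.
rewrite /ds_drho /derive1 /derive.
suff -> : (fun h : R => h^-1 *: (s (h + r) e - s r e)) =
   (fun h : R => h^-1 *: (((fun p => s p.1 p.2) \o shift (r, e)) (h *: ((1, 0) : R * R))
     - s r e)) by [].
by apply/funext => h /=; rewrite scaler0 add0r [h%:A]mulr1.
Qed.

Lemma ds_deE r e : ds_de s r e = 'D_(0, 1) (fun p => s p.1 p.2) (r, e).
Proof.
rewrite /ds_de /derive1 /derive.
suff -> : (fun h : R => h^-1 *: (s r (h + e) - s r e)) =
   (fun h : R => h^-1 *: (((fun p => s p.1 p.2) \o shift (r, e)) (h *: ((0, 1) : R * R))
     - s r e)) by [].
by apply/funext => h /=; rewrite scaler0 add0r [h%:A]mulr1.
Qed.

Let F p := f (s p.1 p.2).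

Lemma twice_differentiable_entropy : twice_differentiable_on quadrant F.
Proof.
by apply: twice_differentiable_comp1 => //; [exact: open_quadrant|exact: entropy_regular law].
Qed.

Lemma derive_entropy p v : quadrant p ->
  'D_v F p = derive1 f (s p.1 p.2) * 'D_v (fun p => s p.1 p.2) p.
Proof.
move=> Qp; have [ds _] := entropy_regular law Qp.
have dfp x : differentiable f x by exact/derivable1_diffP.
have dc : differentiable F p.
  by apply: (@differentiable_comp _ _ _ _ (fun p : R * R => s p.1 p.2) f).
rewrite deriveE// (@diff_comp _ _ _ _ (fun p : R * R => s p.1 p.2) f)//=.
by rewrite -(deriveE v ds) diff1E// mulrC.
Qed.

(** Gibbs' relation for [F = f(s)]: both partial derivatives of [F] carry the same factor [f'(s)],
    so the defining relation of [pressure] passes from [s] to [F]. Positive temperature allows the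
    division. *)
Lemma pressure_entropy r e : 0 < r -> 0 < e ->
  pressure s r e * 'D_(0, 1) F (r, e) = - r ^+ 2 * 'D_(1, 0) F (r, e).
Proof.
move=> r0 e0; have Q : quadrant (r, e) by [].
rewrite (derive_entropy (0, 1) Q) (derive_entropy (1, 0) Q) -ds_drhoE -ds_deE /pressure.
have := temperature_gt0 law r0 e0; set se := ds_de s r e => se0.
by field; rewrite gt_eqF.
Qed.

(** The pressure is built from first derivatives of [s], which are differentiable, and its
    denominator is positive. *)
Lemma differentiable_pressure p : quadrant p ->
  differentiable (fun p => pressure s p.1 p.2) p.
Proof.
move=> Qp; have [_ ds] := entropy_regular law Qp.
have -> : (fun p => pressure s p.1 p.2) = (fun p => - (p.1 ^+ 2)
    * 'D_(1, 0) (fun p => s p.1 p.2) p / 'D_(0, 1) (fun p => s p.1 p.2) p).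
  by apply/funext => -[r e]; rewrite /pressure ds_drhoE ds_deE.
have d1 : differentiable (fst : R * R -> R) p.
  by apply: linear_differentiable => q; exact: cvg_fst.
apply: (@differentiableM _ _ (fun p => - (p.1 ^+ 2) * 'D_(1, 0) (fun p => s p.1 p.2) p)
   (fun p => ('D_(0, 1) (fun p => s p.1 p.2) p)^-1)).
  apply: (@differentiableM _ _ (fun p => - (p.1 ^+ 2))) => //.
  by apply: differentiableN; exact: (differentiableM d1 d1).
apply: differentiableV => //; case: p Qp {ds d1} => r e [r0 e0].
by rewrite -ds_deE gt_eqF// temperature_gt0.
Qed.

End Thermodynamics.

(** * Derivatives of internal energy and entropy density along a family of states *)

Section StateDerivatives.
Context {R : realType} {d : nat} {V : normedModType R}.
Variables (mu : R) (U : V -> R * 'cV[R]_d * R * 'cV[R]_d) (z v : V).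
Variables (dr dE : R) (dm dB : 'I_d -> R).
Hypothesis mu_neq0 : mu != 0.
Hypothesis rho_neq0 : density (U z) != 0.
Hypothesis Drho : is_derive z v (fun y => density (U y)) dr.
Hypothesis Dm : forall i, is_derive z v (fun y => momentum (U y) i 0) (dm i).
Hypothesis DE : is_derive z v (fun y => energy (U y)) dE.
Hypothesis DB : forall i, is_derive z v (fun y => magnetic (U y) i 0) (dB i).

Let e := internal_energy mu (U z).
Let u i := velocity (U z) i 0.

Lemma is_derive_dot_self (w : V -> 'cV[R]_d) (dw : 'I_d -> R) :
  (forall i, is_derive z v (fun y => w y i 0) (dw i)) ->
  is_derive z v (fun y => dot (w y) (w y)) (2 * \sum_i w z i 0 * dw i).
Proof.
move=> Dw; apply: (is_derive_eq (is_derive_bigsum (fun i => is_derive_mul (Dw i) (Dw i)))).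
by rewrite mulr_sumr; apply: eq_bigr => i _; ring.
Qed.

Lemma is_derive_magnetic_energy :
  is_derive z v (fun y => magnetic_energy mu (U y))
    (mu^-1 * \sum_i magnetic (U z) i 0 * dB i).
Proof.
apply: (is_derive_eq (is_derive_scale (2 * mu)^-1 (is_derive_dot_self DB))).
by field.
Qed.

(** Comes from differentiating [rho e = E - |m|^2 / (2 rho) - |B|^2 / (2 mu)]: the kinetic term
    contributes [- u . dm + |u|^2 / 2 dr], and [- e dr] is moved over from the left-hand side. *)
Definition internal_energy_variation : R :=
  (density (U z))^-1 * (dE - mu^-1 * (\sum_i magnetic (U z) i 0 * dB i)
    - \sum_i u i * dm i + (2^-1 * (\sum_i u i ^+ 2) - e) * dr).

Lemma is_derive_internal_energy :
  is_derive z v (fun y => internal_energy mu (U y)) internal_energy_variation.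
Proof.
have rho2 : 2 * density (U z) != 0 by rewrite mulf_neq0// pnatr_eq0.
have Dinv := is_derive_inv (a := fun y => density (U y)) rho_neq0 Drho.
have Dinv2 := is_derive_inv (a := fun y => 2 * density (U y)) rho2 (is_derive_scale 2 Drho).
have D := is_derive_mul Dinv (is_derive_sub (is_derive_sub DE
  (is_derive_mul Dinv2 (is_derive_dot_self Dm))) is_derive_magnetic_energy).
apply: (is_derive_eq D).
rewrite /internal_energy_variation.
have -> : \sum_i u i * dm i = (density (U z))^-1 * \sum_i momentum (U z) i 0 * dm i.
  by rewrite mulr_sumr; apply: eq_bigr => i _; rewrite /u mxE mulrA.
have -> : \sum_i u i ^+ 2 = (density (U z))^-1 ^+ 2 * dot (momentum (U z)) (momentum (U z)).
  by rewrite mulr_sumr; apply: eq_bigr => i _; rewrite /u mxE; ring.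
rewrite /e /internal_energy /=.
have r0 := rho_neq0; set r := density (U z) in r0 *.
set M := dot _ _; set X := \sum_i _; set Y := \sum_i _.
set b := magnetic_energy _ _; set E := energy _.
by field; rewrite r0.
Qed.

Variables (s : R -> R -> R) (f : R -> R).
Hypothesis law : entropy_law s.
Hypothesis df : forall x, derivable f x 1.
Hypothesis d2f : forall x, derivable (derive1 f) x 1.
Hypothesis Uz : admissible mu (U z).

Let F (p : R * R) := f (s p.1 p.2).

(** Serves two families: for the identity on states it gives the directional derivative of
    [rho f(s)] that convexity compares with, and for the solution it gives the space-time
    derivatives. *)
Lemma is_derive_entropy_density :
  is_derive z v (fun y => density (U y) * f (specific_entropy mu s (U y)))
    (dr * f (specific_entropy mu s (U z)) + density (U z) *
       ('D_(1, 0) F (density (U z), e) * dr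
        + 'D_(0, 1) F (density (U z), e) * internal_energy_variation)).
Proof.
apply: (is_derive_mul Drho).
apply: (is_derive_comp2 (G := F) _ Drho is_derive_internal_energy).
have Q : quadrant (density (U z), internal_energy mu (U z)) by [].
by have [] := twice_differentiable_entropy law df d2f Q.
Qed.

End StateDerivatives.

(** * Tangent plane of the Harten entropy *)

Section HartenTangent.
Context {R : realType} {d : nat}.
Local Notation state := (R * 'cV[R]_d * R * 'cV[R]_d)%type.

Variables (mu : R) (s : R -> R -> R) (f : R -> R) (X Y : state).
Hypothesis mu_gt0 : 0 < mu.
Hypothesis law : entropy_law s.
Hypothesis harten : @harten_entropy R d mu s f.
Hypothesis aX : admissible mu X.
Hypothesis aY : admissible mu Y.

Let F (p : R * R) := f (s p.1 p.2).
Let e := internal_energy mu X.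
Let u i := velocity X i 0.
Let Fr := 'D_(1, 0) F (density X, e).
Let Fe := 'D_(0, 1) F (density X, e).

(** This is [convex_tangent] for [eta = - rho f(s)] at [X] in the direction [Y - X], with signs
    reversed. The coordinates are linear in the state, so their derivatives in this direction are
    the increments. *)
Lemma harten_tangent :
  density Y * f (specific_entropy mu s Y) - density X * f (specific_entropy mu s X)
  <= (f (specific_entropy mu s X) + density X * Fr
        + Fe * (2^-1 * (\sum_i u i ^+ 2) - e)) * (density Y - density X)
     - Fe * (\sum_i u i * (momentum Y i 0 - momentum X i 0))
     + Fe * (energy Y - energy X
             - mu^-1 * \sum_i magnetic X i 0 * (magnetic Y i 0 - magnetic X i 0)).
Proof.
have [df d2f cvx] := harten.
have Drho : is_derive X (Y - X) (fun W : state => density W) (density Y - density X).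
  exact: (is_derive_linear (f := fun W : state => density W)).
have DE : is_derive X (Y - X) (fun W : state => energy W) (energy Y - energy X).
  exact: (is_derive_linear (f := fun W : state => energy W)).
have Dm i : is_derive X (Y - X) (fun W : state => momentum W i 0)
    (momentum Y i 0 - momentum X i 0).
  apply: is_derive_eq.
    apply: (is_derive_linear (f := fun W : state => momentum W i 0)) => h W W'.
    by rewrite /momentum /= !mxE.
  by rewrite /momentum /= !mxE.
have DB i : is_derive X (Y - X) (fun W : state => magnetic W i 0)
    (magnetic Y i 0 - magnetic X i 0).
  apply: is_derive_eq.
    apply: (is_derive_linear (f := fun W : state => magnetic W i 0)) => h W W'.
    by rewrite /magnetic /= !mxE.
  by rewrite /magnetic /= !mxE.
have r0 : density X != 0 by rewrite gt_eqF//; case: aX.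
have mu_neq0 : mu != 0 by rewrite gt_eqF.
have D := is_derive_entropy_density (U := fun W : state => W)
  mu_neq0 r0 Drho Dm DE DB law df d2f aX.
have [+ +] := is_derive_opp D.
have HE : harten_eta mu s f =
    (fun W : state => - (density W * f (specific_entropy mu s W))).
  by apply: (@funext state R) => W; rewrite /harten_eta mulNr.
rewrite -HE.
move=> dH DH.
have := convex_tangent cvx aX _ dH; rewrite subrK => /(_ aY).
rewrite DH /harten_eta /internal_energy_variation -/F -/e.
rewrite -/Fr -/Fe.
have -> : \sum_i velocity X i 0 * (momentum Y i 0 - momentum X i 0) =
  \sum_i u i * (momentum Y i 0 - momentum X i 0) by [].
rewrite -[\sum_i velocity X i 0 ^+ 2]/(\sum_i u i ^+ 2).
set r := density X in r0 *; set M := \sum_i u i * _; set N := \sum_i u i ^+ 2.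
set A := \sum_i _.
(* The two differences agree as rational expressions: [density X] cancels the inverse in
   [internal_energy_variation]. *)
rewrite -subr_ge0 => T; rewrite -subr_ge0; apply: le_trans T _.
by rewrite le_eqVlt; apply/orP; left; apply/eqP; field; rewrite r0 mu_neq0.
Qed.

End HartenTangent.

(** Splits the viscous terms by direction, so that diffusion can be estimated one second derivative
    at a time. *)
Lemma sum_combination (K : comRingType) (d : nat) (k a c : K) (u x w : 'I_d -> K)
    (y : 'I_d -> 'I_d -> K) :
  a * (k * \sum_j x j) - c * (\sum_i u i * (k * \sum_j y i j)) + c * (k * \sum_j w j)
  = k * \sum_j (a * x j - c * (\sum_i u i * y i j) + c * w j).
Proof.
have -> : \sum_i u i * (k * \sum_j y i j) = k * \sum_j \sum_i u i * y i j.
  rewrite exchange_big mulr_sumr; apply: eq_bigr => i _.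
  by rewrite -mulr_sumr mulrCA.
by rewrite big_split sumrB /= -!mulr_sumr; ring.
Qed.

(** * Regularity along a smooth viscous solution *)

Section ViscousMHD.
Context {R : realType} {d : nat}.
Local Notation V := (R * 'cV[R]_d)%type.
Local Notation state := (R * 'cV[R]_d * R * 'cV[R]_d)%type.
Variables (T eps mu : R) (s : R -> R -> R) (f : R -> R) (U : V -> state).
Hypothesis eps_gt0 : 0 < eps.
Hypothesis mu_gt0 : 0 < mu.
Hypothesis law : entropy_law s.
Hypothesis harten : @harten_entropy R d mu s f.
Hypothesis sol : smooth_viscous_mhd_solution T eps mu s U.
Hypothesis div0 : forall x, div (magnetic \o U) (0, x) = 0.

Local Notation O := (@open_slab R d T).
Local Notation td := (twice_differentiable_on O).
Let openO : open O := @open_open_slab R d T.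
Let mu_neq0 : mu != 0. Proof. by rewrite gt_eqF. Qed.
Let df := harten_derivable harten.
Let d2f := harten_derivable2 harten.

Let rho z := density (U z).
Let m i z := momentum (U z) i 0.
Let En z := energy (U z).
Let B i z := magnetic (U z) i 0.
Let u i z := velocity (U z) i 0.
Let e z := internal_energy mu (U z).
Let b z := magnetic_energy mu (U z).
Let p z := state_pressure mu s (U z).
Let fs z := f (specific_entropy mu s (U z)).
Let g z := rho z * fs z.
Let W z := En z - b z.
Let F (q : R * R) := f (s q.1 q.2).
Let dir (j : 'I_d) : V := (0, delta_mx j 0).

Lemma solution_admissible_slab z : O z -> admissible mu (U z).
Proof.
case: z => t x /andP[t0 tT].
by apply: (solution_admissible sol); rewrite (ltW t0).
Qed.

Let adm := solution_admissible_slab.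
Let rho_neq0 z : O z -> rho z != 0.
Proof. by move=> /adm[r0 _]; rewrite gt_eqF. Qed.

Let tdrho : td rho.
Proof. exact: smooth_on_twice_differentiable (smooth_density sol). Qed.
Let tdm i : td (m i).
Proof. exact: smooth_on_twice_differentiable (smooth_momentum sol i). Qed.
Let tdE : td En.
Proof. exact: smooth_on_twice_differentiable (smooth_energy sol). Qed.
Let tdB i : td (B i).
Proof. exact: smooth_on_twice_differentiable (smooth_magnetic sol i). Qed.

Let uE i z : u i z = (rho z)^-1 * m i z. Proof. by rewrite /u mxE. Qed.

Let tdu i : td (u i).
Proof.
have := twice_differentiable_mul openO (twice_differentiable_inv openO rho_neq0 tdrho) (tdm i).
by apply: (twice_differentiable_eq openO) => z _; rewrite uE.
Qed.

Let td_dot_self (w : 'I_d -> V -> R) : (forall i, td (w i)) ->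
  td (fun z => \sum_i w i z * w i z).
Proof.
by move=> tw; apply: (twice_differentiable_sum openO) => i; exact: twice_differentiable_mul.
Qed.

Let tdb : td b.
Proof. exact: (twice_differentiable_scale openO _ (td_dot_self tdB)). Qed.

Let tdW : td W. Proof. exact: twice_differentiable_sub. Qed.

Let tde : td e.
Proof.
apply: (twice_differentiable_mul openO (twice_differentiable_inv openO rho_neq0 tdrho)).
apply: (twice_differentiable_sub openO _ tdb).
apply: (twice_differentiable_sub openO tdE).
apply: (twice_differentiable_mul openO _ (td_dot_self tdm)).
apply: (twice_differentiable_inv openO _ (twice_differentiable_scale openO 2 tdrho)).
by move=> z Oz; rewrite mulf_neq0 ?rho_neq0// pnatr_eq0.
Qed.

Let tdfs : td fs.
Proof.
apply: (twice_differentiable_comp2 openO (G := F) (twice_differentiable_entropy law df d2f)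
  _ tdrho tde).
by move=> z /adm.
Qed.

Let tdg : td g. Proof. exact: twice_differentiable_mul. Qed.

(** The pressure already contains first derivatives of [s], so only one derivative of it is
    available; the fluxes are differentiated just once. *)
Let derivable_p z v : O z -> derivable p z v.
Proof.
move=> Oz; apply: diff_derivable.
have [dr _] := tdrho Oz; have [de _] := tde Oz.
apply: (@differentiable_comp _ _ _ _ (fun z => (rho z, e z)) (fun q => pressure s q.1 q.2)).
  exact: differentiable_pair.
by apply: (differentiable_pressure law); exact: adm.
Qed.

(** * First derivatives of the state quantities and fluxes *)

Section Pointwise.
Variables (z v : V).
Hypothesis Oz : O z.

Let is_derive_td h : td h -> is_derive z v h ('D_v h z).
Proof. by move=> th; exact: twice_differentiableW th Oz. Qed.

Lemma momentum_variation i : 'D_v (m i) z = u i z * 'D_v rho z + rho z * 'D_v (u i) z.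
Proof.
have E y : O y -> m i y = rho y * u i y by move=> Oy; rewrite uE mulVKf ?rho_neq0.
rewrite (near_open_derive openO v Oz E).
have [_ ->] := is_derive_mul (is_derive_td tdrho) (is_derive_td (tdu i)).
by rewrite [_ * u i z]mulrC.
Qed.

Lemma magnetic_energy_variation : 'D_v b z = mu^-1 * \sum_i B i z * 'D_v (B i) z.
Proof.
by have [_ ->] := is_derive_magnetic_energy mu_neq0 (fun i => is_derive_td (tdB i)).
Qed.

Let is_derive_e := is_derive_internal_energy mu_neq0 (rho_neq0 Oz) (is_derive_td tdrho)
  (fun i => is_derive_td (tdm i)) (is_derive_td tdE) (fun i => is_derive_td (tdB i)).

(** The factor [rho z] matches the hypotheses on [ex] and [et] in [entropy_balance]. *)
Lemma energy_variation : rho z * 'D_v e z = 'D_v En z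
  - mu^-1 * (\sum_i B i z * 'D_v (B i) z) - \sum_i u i z * 'D_v (m i) z
  + (2^-1 * (\sum_i u i z ^+ 2) - e z) * 'D_v rho z.
Proof.
have [_ ->] := is_derive_e.
by rewrite /internal_energy_variation mulVKf ?rho_neq0.
Qed.

Lemma entropy_variation : 'D_v g z = 'D_v rho z * fs z + rho z *
  ('D_(1, 0) F (rho z, e z) * 'D_v rho z + 'D_(0, 1) F (rho z, e z) * 'D_v e z).
Proof.
have [_ ->] := is_derive_entropy_density mu_neq0 (rho_neq0 Oz) (is_derive_td tdrho)
  (fun i => is_derive_td (tdm i)) (is_derive_td tdE) (fun i => is_derive_td (tdB i))
  law df d2f (adm Oz).
by have [_ ->] := is_derive_e.
Qed.

Lemma momentum_flux_variation i j :
  'D_v (fun y => momentum_flux mu s (U y) i j) z =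
  'D_v (u i) z * m j z + u i z * 'D_v (m j) z
  - mu^-1 * ('D_v (B i) z * B j z + B i z * 'D_v (B j) z)
  + (i == j)%:R * ('D_v p z + 'D_v b z).
Proof.
have -> : (fun y => momentum_flux mu s (U y) i j) = (fun y =>
    u i y * m j y - mu^-1 * (B i y * B j y) + (i == j)%:R * (p y + b y)).
  apply/funext => y; rewrite /momentum_flux !mxE !big_ord1 !mxE uE mulrA.
  by rewrite mulr_natl.
have [_ ->//] := is_derive_add (is_derive_sub
   (is_derive_mul (is_derive_td (tdu i)) (is_derive_td (tdm j)))
   (is_derive_scale mu^-1 (is_derive_mul (is_derive_td (tdB i)) (is_derive_td (tdB j)))))
   (is_derive_scale (i == j)%:R (is_derive_add (derivableP (derivable_p (v := v) Oz))
      (is_derive_td tdb))).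
Qed.

Lemma energy_flux_variation j :
  'D_v (fun y => energy_flux mu s (U y) j 0) z =
  ('D_v En z + 'D_v p z + 'D_v b z) * u j z + (En z + p z + b z) * 'D_v (u j) z
  - (mu^-1 * (\sum_i ('D_v (B i) z * u i z + B i z * 'D_v (u i) z)) * B j z
     + mu^-1 * (\sum_i B i z * u i z) * 'D_v (B j) z).
Proof.
have -> : (fun y => energy_flux mu s (U y) j 0) = (fun y =>
    (En y + p y + b y) * u j y - mu^-1 * (\sum_i B i y * u i y) * B j y).
  by apply/funext => y; rewrite /energy_flux uE !mxE.
have D1 := is_derive_mul (is_derive_add (is_derive_add (is_derive_td tdE)
  (derivableP (derivable_p (v := v) Oz))) (is_derive_td tdb)) (is_derive_td (tdu j)).
have D2 := is_derive_mul (is_derive_scale mu^-1 (is_derive_bigsum (fun i =>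
  is_derive_mul (is_derive_td (tdB i)) (is_derive_td (tdu i))))) (is_derive_td (tdB j)).
by have [_ ->] := is_derive_sub D1 D2.
Qed.

Lemma magnetic_flux_variation i j :
  'D_v (fun y => magnetic_flux (U y) i j) z =
  ('D_v (B i) z * u j z + B i z * 'D_v (u j) z)
  - ('D_v (u i) z * B j z + u i z * 'D_v (B j) z).
Proof.
have -> : (fun y => magnetic_flux (U y) i j) = (fun y => B i y * u j y - u i y * B j y).
  apply/funext => y; rewrite /magnetic_flux !mxE !big_ord1 !mxE !uE.
  by rewrite /B /m /rho; ring.
by have [_ ->] := is_derive_sub (is_derive_mul (is_derive_td (tdB i)) (is_derive_td (tdu j)))
  (is_derive_mul (is_derive_td (tdu i)) (is_derive_td (tdB j))).
Qed.

End Pointwise.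

(** * Entropy balance, diffusion and sign of the production *)

Lemma solution_eq_slab z : O z -> viscous_mhd eps mu s U z.
Proof. by case: z => t x /(solution_eq sol). Qed.

(** The induction flux is [B u^T - u B^T], hence antisymmetric, and the induction equation carries
    no diffusion, so [divergence_free_preserved] applies. *)
Lemma divergence_free z : O z -> \sum_j 'D_(dir j) (B j) z = 0.
Proof.
case: z => t x Oz.
apply: (divergence_free_preserved (A := fun y => magnetic_flux (U y)) _ _ _ _ div0 _ Oz).
- exact: smooth_magnetic sol.
- move=> i j.
  have := twice_differentiable_sub openO (twice_differentiable_mul openO (tdB i) (tdu j))
    (twice_differentiable_mul openO (tdu i) (tdB j)).
  apply: (twice_differentiable_eq openO) => y _.
  rewrite /magnetic_flux !mxE !big_ord1 !mxE !uE.
  by rewrite /B /m /rho; ring.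
- by move=> y i j; rewrite /magnetic_flux !mxE !big_ord1 !mxE; ring.
- by move=> y /solution_eq_slab[].
Qed.

Let kin z := 2^-1 * \sum_i u i z ^+ 2.
Let Fr z := 'D_(1, 0) F (rho z, e z).
Let Fe z := 'D_(0, 1) F (rho z, e z).
Let alpha z := fs z + rho z * Fr z + Fe z * (kin z - e z).

(** This is [entropy_balance] with the viscous terms of the mass, momentum and energy equations as
    [a], [c] and [w]. *)
Lemma entropy_transport z : O z ->
  'D_(1, 0) g z + \sum_j ('D_(dir j) g z * u j z + g z * 'D_(dir j) (u j) z)
  = alpha z * (eps * lap rho z) - Fe z * (\sum_i u i z * (eps * lap (m i) z))
    + Fe z * (eps * lap W z).
Proof.
move=> Oz; have [eq_rho eq_m eq_E eq_B] := solution_eq_slab Oz.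
have [r0 e0] := adm Oz.
have mE j : m j z = rho z * u j z by rewrite uE mulVKf ?rho_neq0.
have mx i j := momentum_variation (dir j) Oz i.
have bx j := magnetic_energy_variation (dir j) Oz.
have ex j := energy_variation (dir j) Oz.
have gx j := entropy_variation (dir j) Oz.
have bE : b z = (2 * mu)^-1 * \sum_i B i z ^+ 2.
  by rewrite /b /magnetic_energy /dot; under eq_bigr do rewrite -expr2.
have energyE : En z = rho z * e z + rho z * kin z + (2 * mu)^-1 * \sum_i B i z ^+ 2.
  have -> : kin z = 2^-1 * (\sum_i (rho z)^-1 ^+ 2 * (m i z * m i z)).
    by congr (_ * _); apply: eq_bigr => i _; rewrite uE; ring.
  rewrite -mulr_sumr -bE /e /internal_energy /dot.
  rewrite -/(rho z) -/(En z) -/(b z).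
  rewrite -[\sum_i momentum (U z) i 0 * momentum (U z) i 0]/(\sum_i m i z * m i z).
  set M := \sum_i _; have r1 := rho_neq0 Oz; set r := rho z in r1 *.
  by field; rewrite r1.
have pE : p z * Fe z = - rho z ^+ 2 * Fr z by exact: (pressure_entropy law df r0 e0).
transitivity ('D_(1, 0) rho z * fs z + rho z *
    (Fr z * 'D_(1, 0) rho z + Fe z * 'D_(1, 0) e z)
  + \sum_j (('D_(dir j) rho z * fs z + rho z *
    (Fr z * 'D_(dir j) rho z + Fe z * 'D_(dir j) e z)) * u j z
    + rho z * fs z * 'D_(dir j) (u j) z)).
  by rewrite (entropy_variation (1, 0) Oz); congr (_ + _); apply: eq_bigr => j _; rewrite gx.
apply: (entropy_balance (fs z) mu_neq0 energyE pE mx ex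
   (energy_variation (1, 0) Oz) eq_rho _ _ _ (divergence_free Oz)
   (px := fun j => 'D_(dir j) p z)).
- move=> i.
  have := congr1 (fun M : 'cV[R]_d => M i 0) eq_m; rewrite !mxE => <-.
  congr (_ + _); transitivity (\sum_j 'D_(dir j) (fun y => momentum_flux mu s (U y) i j) z).
    under [in RHS]eq_bigr do rewrite (momentum_flux_variation _ Oz) mE.
    rewrite [in RHS]big_split /=; congr (_ + _).
    (* The identity matrix contributes only at [j = i], turning the divergence of the isotropic part
       into a derivative in direction [i]. *)
    rewrite [in RHS](bigD1 i)//= eqxx mul1r bx [X in _ = _ + X]big1 ?addr0// => j /negPf ji.
    by rewrite eq_sym ji mul0r.
  by [].
- rewrite -eq_E; congr (_ + _); apply: eq_bigr => j _.
  by rewrite /dx -/(dir j) (energy_flux_variation _ Oz) bx bE.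
- move=> i; have := congr1 (fun M : 'cV[R]_d => M i 0) eq_B; rewrite !mxE; apply: etrans.
  congr (_ + _); apply: eq_bigr => j _.
  by rewrite /dx -/(dir j) (magnetic_flux_variation _ Oz).
Qed.

(* The function [g - alpha rho + Fe (u . m) - Fe W], with the coefficients
   frozen at [z], is maximal at [z]: this is [harten_tangent] at the states
   [(rho, m, W, 0)]. *)
Lemma entropy_diffusion z j : O z ->
  'D_(dir j) ('D_(dir j) g) z <=
  alpha z * 'D_(dir j) ('D_(dir j) rho) z
  - Fe z * (\sum_i u i z * 'D_(dir j) ('D_(dir j) (m i)) z)
  + Fe z * 'D_(dir j) ('D_(dir j) W) z.
Proof.
move=> Oz; set v := dir j.
pose psi y := g y - (alpha z * rho y - Fe z * (\sum_i u i z * m i y) + Fe z * W y).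
have tdscale c h : td h -> td (fun y => c * h y) by exact: twice_differentiable_scale.
have tdpsi : td psi.
  apply: (twice_differentiable_sub openO tdg).
  apply: (twice_differentiable_add openO _ (tdscale _ _ tdW)).
  apply: (twice_differentiable_sub openO (tdscale _ _ tdrho)).
  by apply: (tdscale (Fe z)); apply: (twice_differentiable_sum openO) => i; exact: tdscale.
have psi_max : \forall y \near z, psi y <= psi z.
  apply: (near_open openO) => // y Oy.
  (* Removing the magnetic field while lowering the energy from [En] to [W] leaves the internal
     energy, hence the entropy, unchanged. *)
  pose S y : state := (rho y, momentum (U y), W y, 0).
  have ieS y' : internal_energy mu (S y') = internal_energy mu (U y').
    have BS : magnetic_energy mu (S y') = 0.
      by rewrite /magnetic_energy /dot big1 ?mulr0// => i _; rewrite mxE mul0r.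
    by rewrite /internal_energy BS subr0 [in RHS]addrAC.
  have seS y' : specific_entropy mu s (S y') = specific_entropy mu s (U y').
    by rewrite /specific_entropy ieS.
  have aS y' : O y' -> admissible mu (S y').
    by move=> /adm[r0 e0]; split; rewrite ?ieS.
  have := harten_tangent mu_gt0 law harten (aS _ Oz) (aS _ Oy).
  rewrite !seS ieS [X in mu^-1 * X]big1 => [|i _]; last by rewrite mxE mul0r.
  rewrite mulr0 subr0.
  have -> : \sum_i velocity (S z) i 0 * (momentum (S y) i 0 - momentum (S z) i 0) =
      \sum_i u i z * m i y - \sum_i u i z * m i z.
    by rewrite -sumrB; apply: eq_bigr => i _; rewrite mulrBr.
  have -> : 2^-1 * (\sum_i velocity (S z) i 0 ^+ 2) = kin z by [].
  rewrite -/(fs z) -/(fs y) -/(Fr z) -/(Fe z) -/(e z) /= -/(alpha z) -/(g y) -/(g z).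
  rewrite -subr_ge0 => H; rewrite -subr_ge0; apply: le_trans H _.
  rewrite le_eqVlt; apply/orP; left; apply/eqP.
  rewrite -[density (S y)]/(rho y) -[density (S z)]/(rho z).
  by rewrite -[energy (S y)]/(W y) -[energy (S z)]/(W z) /psi; ring.
have Dpsi y : O y -> 'D_v psi y = 'D_v g y - (alpha z * 'D_v rho y
    - Fe z * (\sum_i u i z * 'D_v (m i) y) + Fe z * 'D_v W y).
  move=> Oy; have D h : td h -> is_derive y v h ('D_v h y).
    by move=> th; exact: twice_differentiableW th Oy.
  have Dsum := is_derive_bigsum (fun i => is_derive_scale (u i z) (D _ (tdm i))).
  by have [_ ->] := is_derive_sub (D _ tdg) (is_derive_add (is_derive_sub
    (is_derive_scale (alpha z) (D _ tdrho)) (is_derive_scale (Fe z) Dsum))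
    (is_derive_scale (Fe z) (D _ tdW))).
have D2psi : 'D_v ('D_v psi) z = 'D_v ('D_v g) z - (alpha z * 'D_v ('D_v rho) z
    - Fe z * (\sum_i u i z * 'D_v ('D_v (m i)) z) + Fe z * 'D_v ('D_v W) z).
  rewrite (near_open_derive openO v Oz Dpsi).
  have D h : td h -> is_derive z v ('D_v h) ('D_v ('D_v h) z).
    by move=> th; apply: derivableP; exact: (twice_differentiable_derivable2 th Oz).
  have Dsum := is_derive_bigsum (fun i => is_derive_scale (u i z) (D _ (tdm i))).
  by have [_ ->] := is_derive_sub (D _ tdg) (is_derive_add (is_derive_sub
    (is_derive_scale (alpha z) (D _ tdrho)) (is_derive_scale (Fe z) Dsum))
    (is_derive_scale (Fe z) (D _ tdW))).
have : 'D_v ('D_v psi) z <= 0.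
  apply: second_derive_le0 psi_max _ _.
    by apply: (near_open openO) => // y Oy; have [] := twice_differentiableW v tdpsi Oy.
  exact: (twice_differentiable_derivable2 tdpsi Oz).
by rewrite D2psi subr_le0.
Qed.

(** By [entropy_transport] the production is [eps] times the sum over directions of the gaps in
    [entropy_diffusion]. *)
Lemma entropy_production_ge0 z : O z ->
  0 <= 'D_(1, 0) g z + \sum_j ('D_(dir j) g z * u j z + g z * 'D_(dir j) (u j) z)
       - eps * \sum_j 'D_(dir j) ('D_(dir j) g) z.
Proof.
move=> Oz; rewrite (entropy_transport Oz) /lap sum_combination.
rewrite -mulrBr -sumrB mulr_ge0 ?(ltW eps_gt0)//; apply: sumr_ge0 => j _.
by rewrite subr_ge0; exact: entropy_diffusion.
Qed.

(** By the product rule [rho grad f(s) + f(s) grad rho] is [grad g], so the flux is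
    [g u - eps grad g]. This identity holds on the whole open slab and may therefore be
    differentiated once more. *)
Lemma entropy_flux_divergence z : O z ->
  div (fun z => (rho z * fs z) *: velocity (U z) - (eps * rho z) *: grad fs z
                - (eps * fs z) *: grad rho z) z
  = \sum_j ('D_(dir j) g z * u j z + g z * 'D_(dir j) (u j) z)
    - eps * \sum_j 'D_(dir j) ('D_(dir j) g) z.
Proof.
move=> Oz; rewrite mulr_sumr -sumrB; apply: eq_bigr => j _.
have E y : O y ->
    ((rho y * fs y) *: velocity (U y) - (eps * rho y) *: grad fs y
                - (eps * fs y) *: grad rho y) j 0 = g y * u j y - eps * 'D_(dir j) g y.
  move=> Oy; have [_ ->] := is_derive_mul (twice_differentiableW (dir j) tdrho Oy)
    (twice_differentiableW (dir j) tdfs Oy).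
  by rewrite !mxE /dx -/(dir j) /g /u mxE; ring.
rewrite /dx -/(dir j) (near_open_derive openO _ Oz E).
by have [_ ->] := is_derive_sub (is_derive_mul (twice_differentiableW (dir j) tdg Oz)
  (twice_differentiableW (dir j) (tdu j) Oz)) (is_derive_scale eps (derivableP
    (twice_differentiable_derivable2 (v := dir j) (w := dir j) tdg Oz))).
Qed.

End ViscousMHD.

Theorem lemma2p3 (R : realType) (d : nat) (eps mu : R) (s : R -> R -> R)
    (f : R -> R) (T : R) (U : R * 'cV[R]_d -> R * 'cV[R]_d * R * 'cV[R]_d) :
  0 < eps -> 0 < mu ->
  entropy_law s ->
  @harten_entropy R d mu s f ->
  smooth_viscous_mhd_solution T eps mu s U ->
  (forall x : 'cV[R]_d, div (magnetic \o U) (0, x) = 0) ->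
  let rho z := density (U z) in
  let u z := velocity (U z) in
  let fs z := f (specific_entropy mu s (U z)) in
  forall (t : R) (x : 'cV[R]_d), 0 < t < T ->
    dt (fun z => rho z * fs z) (t, x)
    + div (fun z => (rho z * fs z) *: u z
                    - (eps * rho z) *: grad fs z
                    - (eps * fs z) *: grad rho z) (t, x) >= 0.
Proof.
move=> eps0 mu0 law harten sol div0 rho u fs t x Oz.
have Otx : open_slab T (t, x) by exact: Oz.
rewrite (entropy_flux_divergence law harten sol Otx) addrA.
exact: (entropy_production_ge0 eps0 mu0 law harten sol div0 Otx).
Qed.
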